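(* Let $N$ be a nonempty finite set of positive integers and let $A^{(N)}$ be the disjoint union of the Aleshin type automata $A^{(n)}$, $n\in N$. Then the group $G(A^{(N)})$ is a free group on $\sum_{n\in N}(2n+1)$ generators.
   Context: An automaton is a quadruple $(Q,X,\phi,\psi)$ with nonempty sets $Q$ (internal states) and $X$ (finite alphabet), a state transition function $\phi:Q\times X\to Q$ and an output function $\psi:Q\times X\to X$. Let $X^*$ be the set of finite words over $X$ (including the empty word). For an automaton $Y=(Q,X,\phi,\psi)$ and $q\in Q$, the transformation $Y_q:X^*\to X^*$ is defined recursively by $Y_q(\varnothing)=\varnothing$ and $Y_q(xw)=\psi(q,x)\,Y_{\phi(q,x)}(w)$ for $x\in X$, $w\in X^*$. $Y$ is invertible if all $Y_q$, $q\in Q$, are bijective; then $G(Y)$ is the group of transformations of $X^*$ generated (under composition) by $Y_q$, $q\in Q$. Aleshin type automata: for $n\ge1$, $A^{(n)}=(Q_n,\{0,1\},\phi_n,\psi_n)$, where $Q_1=\{a_1,b_1,c_1\}$ and $Q_n=\{a_n,b_n,c_n,q_{n1},\dots,q_{n,2n-2}\}$ for $n\ge2$ (a set of $2n+1$ elements; the sets $Q_n$ for different $n$ are disjoint). With $q_{n0}:=c_n$ and $q_{n,2n-1}:=a_n$: $\phi_n(a_n,0)=\phi_n(b_n,1)=c_n$, $\phi_n(a_n,1)=\phi_n(b_n,0)=b_n$, and $\phi_n(q_{ni},0)=\phi_n(q_{ni},1)=q_{n,i+1}$ for $0\le i\le 2n-2$. For $x\in\{0,1\}$: $\psi_n(q,x)=1-x$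 if $q\in\{a_n,b_n\}$, and $\psi_n(q,x)=x$ if $q\in Q_n\setminus\{a_n,b_n\}$. These automata are invertible. The disjoint union of finitely many automata over the same alphabet $X$ with pairwise disjoint state sets is the automaton over $X$ whose state set is the union of the state sets and whose transition and output functions restrict to those of each component. *)

(* Defs.v *)
From HB Require Import structures.
From mathcomp Require Import all_boot finmap boolp classical_sets.

Set Implicit Arguments.
Unset Strict Implicit.
Unset Printing Implicit Defensive.

Local Open Scope classical_set_scope.
Local Open Scope group_scope.

(** The group of all bijections of a type, under composition:
    [(f * g) x = f (g x)]. *)
Record self_bij (T : Type) :=
  SelfBij { bij_fun :> T -> T; _ : `[< bijective bij_fun >] }.

HB.instance Definition _ (T : Type) := [isSub for @bij_fun T].
HB.instance Definition _ (T : choiceType) := [Choice of self_bij T by <:].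

Section BijGroup.
Variable T : choiceType.
Implicit Types f g : self_bij T.

Lemma bijP f : bijective f.
Proof. by case: f => f bf; apply/asboolP. Qed.

Definition mk_bij (f : T -> T) (bf : bijective f) : self_bij T :=
  SelfBij (introT (asboolP _) bf).

Lemma bij_eqP f g : f =1 g -> f = g.
Proof. by move=> fg; apply/val_inj/funext. Qed.

Lemma bij_inv_subproof f : exists g : T -> T, cancel f g /\ cancel g f.
Proof. by have [g fK gK] := bijP f; exists g. Qed.

Definition bij_inv_fun f : T -> T := sval (cid (bij_inv_subproof f)).

Lemma bij_funK f : cancel f (bij_inv_fun f).
Proof. by rewrite /bij_inv_fun; case: cid => g []. Qed.

Lemma bij_inv_funK f : cancel (bij_inv_fun f) f.
Proof. by rewrite /bij_inv_fun; case: cid => g []. Qed.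

Lemma bij_id : bijective (@id T).
Proof. by exists id. Qed.

Definition bij_one : self_bij T := mk_bij bij_id.
Definition bij_mul f g : self_bij T := mk_bij (bij_comp (bijP f) (bijP g)).
Definition bij_inv f : self_bij T :=
  mk_bij (Bijective (bij_inv_funK f) (bij_funK f)).

Lemma bij_mulA : associative bij_mul.
Proof. by move=> f g h; apply: bij_eqP. Qed.
Lemma bij_mul1 : left_id bij_one bij_mul.
Proof. by move=> f; apply: bij_eqP. Qed.
Lemma bij_mulr1 : right_id bij_one bij_mul.
Proof. by move=> f; apply: bij_eqP. Qed.
Lemma bij_mulV : left_inverse bij_one bij_inv bij_mul.
Proof. by move=> f; apply: bij_eqP => x; exact: bij_funK. Qed.
Lemma bij_mulrV : right_inverse bij_one bij_inv bij_mul.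
Proof. by move=> f; apply: bij_eqP => x; exact: bij_inv_funK. Qed.

HB.instance Definition _ :=
  isGroup.Build (self_bij T) bij_mulA bij_mul1 bij_mulr1 bij_mulV bij_mulrV.

End BijGroup.

Section Generated.
Variables (G : groupType) (S : set G).

Definition is_subgroup (H : set G) : Prop :=
  H 1 /\ forall x y, H x -> H y -> H (x / y).

Definition generated : set G := smallest is_subgroup S.

Definition generated_pred : pred G := [pred x | x \in generated].

Lemma generated_group_closed : group_closed generated_pred.
Proof.
split=> [|x y].
  by rewrite !inE => H [[]].
by rewrite !inE => xS yS H HS; case: (HS) => -[_ HV] _; apply: HV; [apply: xS|apply: yS].
Qed.

Record generated_group :=
  GeneratedGroup { generated_val :> G; _ : generated_pred generated_val }.

HB.instance Definition _ := [isSub for generated_val].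
HB.instance Definition _ := [Choice of generated_group by <:].
HB.instance Definition _ :=
  SubChoice_isSubGroup.Build G generated_pred generated_group
    generated_group_closed.

End Generated.

(** [G] is a free group on the family [b], by the universal property. *)
Definition free_basis (B : Type) (G : groupType) (b : B -> G) : Prop :=
  forall (H : groupType) (f : B -> H),
    exists2 phi : {multiplicative G -> H},
      (forall i, phi (b i) = f i) &
      forall psi : {multiplicative G -> H},
        (forall i, psi (b i) = f i) -> psi =1 phi.

Definition free_of_rank (G : groupType) (k : nat) : Prop :=
  exists b : 'I_k -> G, free_basis b.

Record automaton (X : finType) := Automaton {
  state : Type;
  next : state -> X -> state;
  output : state -> X -> X;
  state_inhabited : inhabited state;
  alphabet_inhabited : inhabited X
}.

Section Automata.
Variable X : finType.
Implicit Types Y : automaton X.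

Fixpoint transf Y (q : state Y) (w : seq X) : seq X :=
  if w is x :: w' then output q x :: transf (next q x) w' else [::].

Definition invertible Y : Prop := forall q : state Y, bijective (transf q).

Definition automaton_group Y (invY : invertible Y) : groupType :=
  generated_group [set mk_bij (invY q) | q in [set: state Y]].

Lemma invertible_output Y :
  (forall q : state Y, bijective (output q)) -> invertible Y.
Proof.
move=> bY.
pose inv q := sval (cid (bij_inv_subproof (mk_bij (bY q)))).
have oK q : cancel (output q) (inv q) by rewrite /inv; case: cid => g [].
have iK q : cancel (inv q) (output q) by rewrite /inv; case: cid => g [].
pose fix back (q : state Y) w :=
  if w is x :: w' then inv q x :: back (next q (inv q x)) w' else [::].
move=> q; exists (back q) => w; elim: w q => //= x w IHw q.
  by rewrite oK IHw.
by rewrite iK IHw.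
Qed.

Section DisjointUnion.
Variables (I : finType) (Y : I -> automaton X) (I_inhabited : inhabited I).

Lemma union_state_inhabited : inhabited {i : I & state (Y i)}.
Proof.
by have [i] := I_inhabited; have [q] := state_inhabited (Y i); exists; exists i.
Qed.

Lemma union_alphabet_inhabited : inhabited X.
Proof. by have [i] := I_inhabited; exact: alphabet_inhabited (Y i). Qed.

Definition disjoint_union : automaton X := {|
  state := {i : I & state (Y i)};
  next q x := existT (fun i => state (Y i)) (tag q) (next (tagged q) x);
  output q x := output (tagged q) x;
  state_inhabited := union_state_inhabited;
  alphabet_inhabited := union_alphabet_inhabited
|}.

End DisjointUnion.
End Automata.

(** [AlQ i] is the state [q_{n,i+1}] of the n-th automaton, so that the indices
    run over [1 .. 2n-2]. *)
Inductive aleshin_state (n : nat) : Type :=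
  AlA | AlB | AlC | AlQ of 'I_(2 * n - 2)%N.
Arguments AlA {n}. Arguments AlB {n}. Arguments AlC {n}.

(** The state [q_{n,k}] for [k <= 2n-1], where [q_{n,0} = c_n] and
    [q_{n,2n-1} = a_n]; the value for larger [k] is irrelevant. *)
Definition aleshin_q (n k : nat) : aleshin_state n :=
  if k is k'.+1 then if insub k' is Some i then AlQ i else AlA else AlC.

(** The letters 0 and 1 are [false] and [true]. *)
Definition aleshin_next (n : nat) (q : aleshin_state n) (x : bool) :
    aleshin_state n :=
  match q with
  | AlA => if x then AlB else AlC
  | AlB => if x then AlC else AlB
  | AlC => aleshin_q n 1
  | AlQ i => aleshin_q n i.+2
  end.

Definition aleshin_output (n : nat) (q : aleshin_state n) (x : bool) : bool :=
  match q with AlA | AlB => ~~ x | AlC | AlQ _ => x end.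

(** Only meaningful for [0 < n]. *)
Definition aleshin (n : nat) : automaton bool := {|
  next := @aleshin_next n;
  output := @aleshin_output n;
  state_inhabited := inhabits AlA;
  alphabet_inhabited := inhabits true
|}.

Section AleshinUnion.
Variables (N : {fset nat}) (N_neq0 : N != fset0).

Lemma fset_inhabited : inhabited N.
Proof. by have /fset0Pn[n nN] := N_neq0; exists; exists n. Qed.

Definition aleshin_union : automaton bool :=
  disjoint_union (fun n : N => aleshin (val n)) fset_inhabited.

Lemma aleshin_union_invertible : invertible aleshin_union.
Proof.
apply: invertible_output => -[n q]; apply: inv_bij => x.
by case: q => //=; exact: negbK.
Qed.

End AleshinUnion.

Arguments aleshin_union {N} N_neq0.
Arguments aleshin_union_invertible {N} N_neq0.

(* Main.v *)
(** Let [e] invert every bit and, for a state [q], let [B_q] be [A_q] followed by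
    [e]. All [B_q] are involutions and [A_q = e B_q], so it suffices that a
    nonempty word in the letters [e], [B_q] without two equal adjacent letters
    acts nontrivially: the group they generate is a free product of groups of
    order 2. Reading a bit turns a word into another one, so the words acting
    trivially are closed under the two transformations [D_0], [D_1] of the dual
    automaton. Up to inverses these are generated by the letterwise permutations
    of [{a_n, b_n, c_n}] (all n at once), by the letterwise cycle [rho] on
    [a_n, q_n1, .., q_n,2n-2], and by the involution exchanging [b_n] and [c_n]
    at the positions preceded by an odd number of letters other than [b]'s and
    [c]'s; [rho] splits off because its order is odd.

    The permutations and the involution see only the symbols a, b, c and a star
    for the remaining letters, and are transitive on the words of symbols without
    equal neighbours that have prescribed stars. Together with [rho], which
    separates different n by the distinct lengths [2n-1] of its cycles, they move
    any word without equal neighbours to one whose word of symbols has no equal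
    neighbours either. The orbit of such a word contains words that invert the
    first bit. *)

From HB Require Import structures.
Require Import Defs.
From mathcomp Require Import all_boot finmap boolp classical_sets.

Set Implicit Arguments.
Unset Strict Implicit.
Unset Printing Implicit Defensive.

(** * Words of symbols *)

(* [SO] is the star: it stands for [e] and for all the states [q_ni]. *)
Inductive sym := SA | SB | SC | SO.

Lemma sym_eq_dec (x y : sym) : {x = y} + {x <> y}.
Proof. by decide equality. Defined.

HB.instance Definition _ := hasDecEq.Build sym (compareP sym_eq_dec).

Definition swapAB s := match s with SA => SB | SB => SA | _ => s end.
Definition swapBC s := match s with SB => SC | SC => SB | _ => s end.
Definition toggles s := match s with SB | SC => false | _ => true end.
Definition flip (p : bool) s := if p then swapBC s else s.

Fixpoint run (p : bool) (r : seq sym) : seq sym :=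
  if r is s :: r' then flip p s :: run (p (+) toggles s) r' else [::].

Fixpoint parity (p : bool) (r : seq sym) : bool :=
  if r is s :: r' then parity (p (+) toggles s) r' else p.

Inductive gen := GenAB | GenBC | GenE.

Definition act g (r : seq sym) : seq sym :=
  match g with
  | GenAB => map swapAB r
  | GenBC => map swapBC r
  | GenE => run false r
  end.

Definition acts gs r := foldl (fun r g => act g r) r gs.

Definition star s := if s is SO then true else false.
Definition reduced (T : eqType) (w : seq T) := sorted (fun x y => x != y) w.
Definition reach r r' := exists gs, acts gs r = r'.

Lemma swapABK : involutive swapAB. Proof. by case. Qed.
Lemma swapBCK : involutive swapBC. Proof. by case. Qed.
Lemma flipK p : involutive (flip p). Proof. by case: p => -[]. Qed.
Lemma flipM p s : flip (~~ p) s = swapBC (flip p s). Proof. by case: p s => -[]. Qed.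
Lemma toggles_flip p s : toggles (flip p s) = toggles s.
Proof. by case: p s => -[]. Qed.
Lemma star_flip p s : star (flip p s) = star s. Proof. by case: p s => -[]. Qed.

Lemma run_cat p r1 r2 : run p (r1 ++ r2) = run p r1 ++ run (parity p r1) r2.
Proof. by elim: r1 p => //= s r IH p; rewrite IH. Qed.

Lemma run_rcons p r z : run p (rcons r z) = rcons (run p r) (flip (parity p r) z).
Proof. by rewrite -!cats1 run_cat. Qed.

Lemma parity_rcons p r z : parity p (rcons r z) = parity p r (+) toggles z.
Proof. by elim: r p => //= s r IH p; rewrite IH. Qed.

Lemma runN p r : run (~~ p) r = map swapBC (run p r).
Proof. by elim: r p => //= s r IH p; rewrite addNb IH flipM. Qed.

Lemma runK p : involutive (run p).
Proof. by move=> r; elim: r p => //= s r IH p; rewrite toggles_flip IH flipK. Qed.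

Lemma actK g : involutive (act g).
Proof.
by case: g => r /=; [exact: (mapK swapABK)|exact: (mapK swapBCK)|exact: runK].
Qed.

Lemma acts_cat gs hs r : acts (gs ++ hs) r = acts hs (acts gs r).
Proof. exact: foldl_cat. Qed.

Lemma acts_revK gs r : acts (rev gs) (acts gs r) = r.
Proof.
elim: gs r => //= g gs IH r.
by rewrite rev_cons -cats1 acts_cat IH /= actK.
Qed.

Lemma reach_refl r : reach r r. Proof. by exists [::]. Qed.
Lemma reach_sym r r' : reach r r' -> reach r' r.
Proof. by case=> gs <-; exists (rev gs); exact: acts_revK. Qed.
Lemma reach_trans r2 r1 r3 : reach r1 r2 -> reach r2 r3 -> reach r1 r3.
Proof. by case=> gs <- [hs <-]; exists (gs ++ hs); exact: acts_cat. Qed.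
Lemma reach_act g r : reach r (act g r). Proof. by exists [:: g]. Qed.

Lemma stars_act g r : map star (act g r) = map star r.
Proof.
case: g => /=; 
  [by rewrite -map_comp; apply: eq_map; case|by rewrite -map_comp; apply: eq_map; case|].
by elim: r false => //= s r IH p; congr (_ :: _); [exact: star_flip | exact: IH].
Qed.
Lemma stars_acts gs r : map star (acts gs r) = map star r.
Proof. by elim: gs r => //= g gs IH r; rewrite IH stars_act. Qed.

Lemma reduced_map (T : eqType) (f : T -> T) (w : seq T) :
  injective f -> reduced (map f w) = reduced w.
Proof.
move=> fi; case: w => //= x w; rewrite path_map; apply: eq_path => y z /=.
by rewrite (inj_eq fi).
Qed.

Lemma reduced_run p r : reduced (run p r) = reduced r.
Proof.
elim: r p => [|s [|s' r] IH] p //.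
have := IH (p (+) toggles s); rewrite /reduced /= => ->; congr (_ && _).
by case: p s s' {IH} => -[] [].
Qed.

Lemma reduced_act g r : reduced (act g r) = reduced r.
Proof.
case: g => /=; last exact: reduced_run.
  by apply: reduced_map; exact: inv_inj swapABK.
by apply: reduced_map; exact: inv_inj swapBCK.
Qed.
Lemma reduced_acts gs r : reduced (acts gs r) = reduced r.
Proof. by elim: gs r => //= g gs IH r; rewrite IH reduced_act. Qed.

(** Two stars toggle the phase twice and are themselves fixed, so inserting them does not change how
    the last symbol is moved. *)
Lemma acts_rconsOO gs r : exists2 f : sym -> sym, injective f /\ f SO = SO &
  forall z, acts gs (rcons r z) = rcons (acts gs r) (f z) /\
    acts gs (rcons (rcons (rcons r SO) SO) z) =
    rcons (rcons (rcons (acts gs r) SO) SO) (f z).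
Proof.
elim: gs r => [|g gs IH] r; first by exists id; [split|]; do ?move=> ?.
have [f [fi fO] fE] := IH (act g r).
pose h z := match g with GenAB => swapAB z | GenBC => swapBC z
            | GenE => flip (parity false r) z end.
have hi : injective h.
  by rewrite /h; case: (g); apply: inv_inj; [exact: swapABK|exact: swapBCK|exact: flipK].
exists (f \o h).
  split; first exact: inj_comp.
  by rewrite /= -[RHS]fO /h; case: (g) => //; case: parity.
move=> z /=; case: (fE (h z)) => <- <-; split; congr acts;
  rewrite /h; case: (g) => /=; rewrite ?map_rcons ?run_rcons ?parity_rcons //=.
by case: parity.
Qed.

Lemma acts_rcons gs r : exists2 f : sym -> sym, injective f /\ f SO = SO &
  forall z, acts gs (rcons r z) = rcons (acts gs r) (f z).
Proof.
by have [f fi fE] := acts_rconsOO gs r; exists f => // z; have [] := fE z.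
Qed.

Lemma parityE p r : parity p r = p (+) parity false r.
Proof.
elim: r p => [|s r IH] p /=; first by rewrite addbF.
by rewrite IH [in RHS]IH addbA.
Qed.

(* The parity to the right of a position is, up to the invariant total parity,
   the parity to its left plus its own contribution, and the latter is 0 at the
   positions that may move. *)
Lemma run_rev p r : run (p (+) parity false r) (rev r) = rev (run p r).
Proof.
elim: r p => //= s r IH p.
rewrite !rev_cons run_rcons -IH; congr rcons.
  congr run; rewrite (parityE (toggles s)).
  by case: p (toggles s) (parity _ _) => -[] [].
have -> : parity (p (+) parity (toggles s) r) (rev r) =
    p (+) toggles s (+) parity false r (+) parity false (rev r).
  by rewrite parityE (parityE (toggles s)) !addbA.
have E : parity false (rev r) = parity false r.
  elim: (r) => //= x l IHl; rewrite rev_cons parity_rcons IHl [RHS]parityE.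
  exact: addbC.
rewrite E; by case: s (parity _ r) p => -[] [].
Qed.

(** Reversal carries generators to products of generators: [GenE] becomes itself or [GenE] followed
    by [GenBC], according to the total parity of the word. *)
Lemma reach_rev r r' : reach r r' -> reach (rev r) (rev r').
Proof.
case=> gs <-; elim: gs r => [|g gs IH] r; first exact: reach_refl.
apply: (reach_trans _ (IH (act g r))).
case: g; [exists [:: GenAB]; exact: map_rev|exists [:: GenBC]; exact: map_rev|].
have := run_rev false r; rewrite addFb.
case: parity => E; last by exists [:: GenE].
by exists [:: GenE; GenBC]; rewrite /= -runN.
Qed.

(** A leading star is fixed and shifts the phase of everything after it, which [GenBC]
    compensates. *)
Lemma reach_consO r r' : reach r r' -> reach (SO :: r) (SO :: r').
Proof.
case=> gs <-; elim: gs r => [|g gs IH] r; first exact: reach_refl.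
apply: (reach_trans _ (IH (act g r))).
case: g; [exact: (reach_act GenAB)|exact: (reach_act GenBC)|].
exists [:: GenE; GenBC] => /=; rewrite (runN false) -map_comp map_id_in // => x _ /=.
exact: swapBCK.
Qed.

(** * Transitivity on reduced words of symbols with prescribed stars *)

Definition connected (t : seq bool) := forall r r',
  reduced r -> reduced r' -> map star r = t -> map star r' = t -> reach r r'.

Definition sparse (t : seq bool) := sorted (fun x y => ~~ (x && y)) t.

Lemma reduced_rev (T : eqType) (w : seq T) : reduced (rev w) = reduced w.
Proof.
rewrite /reduced rev_sorted; case: w => //= x w.
by apply: eq_path => y z; rewrite eq_sym.
Qed.

Lemma sparse_rev t : sparse (rev t) = sparse t.
Proof.
rewrite /sparse rev_sorted; case: t => //= x t.
by apply: eq_path => y z; rewrite andbC.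
Qed.

Lemma sparse_stars r : reduced r -> sparse (map star r).
Proof.
case: r => //= s r; rewrite /sparse /reduced /= path_map.
by apply: sub_path => -[] [].
Qed.

Lemma connected_rev t : connected t -> connected (rev t).
Proof.
move=> ct r r' rr rr' rt rt'; rewrite -[r]revK -[r']revK; apply: reach_rev.
by apply: ct; rewrite ?reduced_rev // map_rev ?rt ?rt' revK.
Qed.

Lemma connected_consO t : connected t -> connected (true :: t).
Proof.
move=> ct [|s r] [|s' r'] //= rr rr' [st rt] [st' rt'].
have -> : s = SO by case: (s) st.
have -> : s' = SO by case: (s') st'.
apply/reach_consO/ct => //; [exact: path_sorted rr|exact: path_sorted rr'].
Qed.

Lemma connected_rconsO t : connected t -> connected (rcons t true).
Proof.
move=> ct; rewrite -[t]revK -rev_cons.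
by apply/connected_rev/connected_consO/connected_rev.
Qed.

(** Connectedness of [t] moves the prefix of any word to the chosen [r0], so exchanging last symbols
    after this single prefix is enough. *)
Lemma connected_rcons t r0 : connected t -> reduced r0 -> map star r0 = t ->
  (forall z z', ~~ star z -> ~~ star z' -> reduced (rcons r0 z) ->
     reduced (rcons r0 z') -> reach (rcons r0 z) (rcons r0 z')) ->
  connected (rcons t false).
Proof.
move=> ct r0r r0t r0z.
have to_r0 r : reduced r -> map star r = rcons t false ->
    exists z, [/\ ~~ star z, reduced (rcons r0 z) & reach r (rcons r0 z)].
  case/lastP: r => [|u z] rr; first by case: (t).
  rewrite map_rcons => /rcons_inj[ut zt].
  have ur : reduced u by move: rr; rewrite /reduced -cats1 => /cat_sorted2[].
  have [gs gsu] := ct _ _ ur r0r ut r0t.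
  have [f _ fE] := acts_rcons gs u.
  exists (f z); split; last by exists gs; rewrite fE gsu.
    have := stars_acts gs (rcons u z); rewrite fE !map_rcons => /rcons_inj[_ ->].
    by rewrite zt.
  by rewrite -gsu -fE reduced_acts.
move=> r r' rr rr' /(to_r0 _ rr)[z [zO rz rrz]] /(to_r0 _ rr')[z' [zO' rz' rrz']].
by apply: (reach_trans rrz); apply: (reach_trans (r0z _ _ zO zO' rz rz')); apply: reach_sym.
Qed.

Lemma connected_cons t r0 : connected t -> reduced r0 -> map star r0 = t ->
  (forall z z', ~~ star z -> ~~ star z' -> reduced (z :: r0) ->
     reduced (z' :: r0) -> reach (z :: r0) (z' :: r0)) ->
  connected (false :: t).
Proof.
move=> ct rr rt rz; rewrite -[_ :: _]revK rev_cons; apply: connected_rev.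
apply: (@connected_rcons _ (rev r0)); first exact: connected_rev.
- by rewrite reduced_rev.
- by rewrite map_rev rt.
move=> z z' zO zO'; rewrite -!rev_cons !reduced_rev => rz1 rz2.
by apply/reach_rev/rz.
Qed.

(* Fixed by [run p]: the letters are [SA] in the flipping phases and alternate
   between [SB] and [SC] in the others. *)
Fixpoint fixed_word (p x : bool) (t : seq bool) : seq sym :=
  match t with
  | [::] => [::]
  | true :: t' => SO :: fixed_word (~~ p) x t'
  | false :: t' => if p then SA :: fixed_word false x t'
                   else (if x then SB else SC) :: fixed_word false (~~ x) t'
  end.

Lemma run_fixed_word p x t : run p (fixed_word p x t) = fixed_word p x t.
Proof.
by elim: t p x => [|[] t IH] [] x //=; case: x => /=; rewrite IH.
Qed.

Lemma stars_fixed_word p x t : map star (fixed_word p x t) = t.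
Proof.
by elim: t p x => [|[] t IH] [] x //=; rewrite IH //; case: x.
Qed.

(** When stars are sparse, a flipping phase is opened by a star and closed at once by the [SA] after
    it; the hypothesis on [s] says this for the symbol in front. *)
Lemma path_fixed_word p x t s :
  (if p then s == SO else s != (if x then SB else SC)) ->
  path (fun x y => ~~ (x && y)) (star s) t ->
  path (fun x y => x != y) s (fixed_word p x t).
Proof.
elim: t p x s => [|[] t IH] [] x s //=.
- by move=> /eqP-> /=.
- by move=> _ /andP[sO pt]; rewrite IH ?andbT //; case: (s) sO.
- by move=> /eqP-> /= pt; rewrite IH //; case: (x).
- by move=> sx /andP[_ pt]; rewrite sx IH //; case: (x).
Qed.

Lemma parity_fixed_word p x t : path (fun x y => ~~ (x && y)) p t ->
  parity p (fixed_word p x t) = last p t.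
Proof.
elim: t p x => [|[] t IH] [] x //= pt; rewrite ?IH //.
by case: x; rewrite IH.
Qed.

Lemma connected_nil : connected [::].
Proof. by move=> [|? ?] [|? ?] // *; exact: reach_refl. Qed.

Lemma connected1 : connected [:: false].
Proof.
apply: (@connected_cons _ [::]) => // [|z z' zO zO' _ _]; first exact: connected_nil.
have ab : reach [:: SA] [:: SB] by exists [:: GenAB].
have bc : reach [:: SB] [:: SC] by exists [:: GenBC].
have toB s : ~~ star s -> reach [:: s] [:: SB].
  by case: s => // _; [exact: reach_refl|exact: reach_sym].
by apply: (reach_trans (toB _ zO)); apply/reach_sym/toB.
Qed.

(** The word [r0] starts with [SA], so only [SB] and [SC] can precede it; [GenE] followed by [GenBC]
    exchanges these two because [run true] fixes [r0]. *)
Lemma connected_cons2 t : sparse (false :: t) -> connected (false :: t) ->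
  connected (false :: false :: t).
Proof.
move=> st ct; pose r0 := fixed_word true true (false :: t).
have r0E : r0 = SA :: fixed_word false true t by [].
apply: (@connected_cons _ r0) => //.
- by rewrite r0E /reduced /= path_fixed_word.
- exact: stars_fixed_word.
have bc : reach (SB :: r0) (SC :: r0).
  exists [:: GenE; GenBC].
  rewrite -[LHS]/(SC :: map swapBC (run (~~ true) r0)) runN run_fixed_word.
  by rewrite mapK //; exact: swapBCK.
have toB s : ~~ star s -> reduced (s :: r0) -> reach (s :: r0) (SB :: r0).
  by case: s => // _ _; [exact: reach_refl|exact: reach_sym].
move=> z z' zO zO' rz rz'; apply: (reach_trans (toB _ zO rz)).
by apply/reach_sym/toB.
Qed.

(* For the fixed word [r0], [SB] and [SC] are exchangeable at the end of
   [y :: rcons r0 z] whatever [y]. If [SA] is not exchangeable with them, the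
   transitivity on the words [y :: r0] relates all the [y :: rcons r0 SA], and
   the first letter is free instead. *)
Lemma connected_cons_rcons m (t := true :: m) : sparse t -> last false t ->
  connected (false :: t) -> connected (rcons t false) ->
  connected (false :: rcons t false).
Proof.
move=> st lt ct tc; pose r0 := fixed_word false true t.
have [m0 r0E] : exists m0, r0 = SO :: m0 by exists (fixed_word true true m).
have r0t : map star r0 = t by exact: stars_fixed_word.
have pr0 : parity false r0 by rewrite parity_fixed_word.
have r0r s : ~~ star s -> reduced (s :: r0).
  have := @path_fixed_word false true t SC erefl st; rewrite /reduced.
  by case: s.
have rr0 : run false r0 = r0 by exact: run_fixed_word.
clearbody r0.
have w_rcons y z : y :: rcons r0 z = rcons (y :: r0) z by [].
have bc y : ~~ star y -> reach (y :: rcons r0 SB) (y :: rcons r0 SC).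
  case: y => // _.
  - exists [:: GenE; GenBC].
    rewrite -[LHS]/(SA :: map swapBC (run (~~ false) (rcons r0 SB))) runN.
    by rewrite (mapK swapBCK) run_rcons rr0 pr0.
  - exists [:: GenE].
    by rewrite -[LHS]/(SB :: run false (rcons r0 SB)) run_rcons rr0 pr0.
  - exists [:: GenE].
    by rewrite -[LHS]/(SC :: run false (rcons r0 SB)) run_rcons rr0 pr0.
pose full y := forall z z', ~~ star z -> ~~ star z' ->
  reach (y :: rcons r0 z) (y :: rcons r0 z').
have fullP y s : ~~ star y -> s \in [:: SB; SC] ->
    reach (y :: rcons r0 SA) (y :: rcons r0 s) -> full y.
  move=> yO sBC As.
  have AB : reach (y :: rcons r0 SA) (y :: rcons r0 SB).
    move: sBC; rewrite !inE => /orP[/eqP<-//|/eqP sC].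
    by apply: (reach_trans As); rewrite sC; apply/reach_sym/bc.
  have toB z : ~~ star z -> reach (y :: rcons r0 z) (y :: rcons r0 SB).
    by case: z => // _; [exact: reach_refl|exact/reach_sym/bc].
  by move=> z z' zO zO'; apply: (reach_trans (toB _ zO)); apply/reach_sym/toB.
(* Carry [y' :: r0] to [y :: r0] and let [f] be the permutation induced on the last symbol. If [f]
   fixes [SA], the second alternative holds. Otherwise [SA] is the image of [SB] or [SC], and the
   exchange of these after [y'] becomes one involving [SA] after [y]. *)
have full_or y y' : ~~ star y -> ~~ star y' ->
    full y \/ reach (y :: rcons r0 SA) (y' :: rcons r0 SA).
  move=> yO yO'.
  have [||||gs gsE] := ct (y' :: r0) (y :: r0); rewrite ?r0r //=.
  - by rewrite r0t; case: (y') yO'.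
  - by rewrite r0t; case: (y) yO.
  have [f [fi fO] fE] := acts_rcons gs (y' :: r0).
  have fr z : reach (y' :: rcons r0 z) (y :: rcons r0 (f z)).
    by exists gs; rewrite w_rcons fE gsE.
  have fBC : reach (y :: rcons r0 (f SB)) (y :: rcons r0 (f SC)).
    by apply: (reach_trans (reach_sym (fr SB))); apply: (reach_trans (bc _ yO')).
  have [fA fB fC] : [/\ f SA != SO, f SB != SO & f SC != SO].
    by rewrite -fO !(inj_eq fi).
  have [fAB fAC fBC'] : [/\ f SA != f SB, f SA != f SC & f SB != f SC].
    by rewrite !(inj_eq fi).
  have [fAA|fAA] := eqVneq (f SA) SA.
    by right; apply: reach_sym; rewrite -[in X in reach _ X]fAA.
  left; case EB: (f SB) fB fAB fBC' fBC => //= _ fAB fBC'.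
  - by move=> /fullP; apply=> //; case: (f SC) fC fBC'.
  - move=> /reach_sym; case EC: (f SC) fC fAC fBC' => //= _ fAC _.
      by move/fullP; apply.
    by case: (f SA) fA fAA fAB fAC.
  - move=> /reach_sym; case EC: (f SC) fC fAC fBC' => //= _ fAC _.
      by move/fullP; apply.
    by case: (f SA) fA fAA fAB fAC.
have full_connected y : ~~ star y -> full y -> connected (false :: rcons t false).
  move=> yO fy; rewrite -rcons_cons.
  apply: (@connected_rcons _ (y :: r0)) => //; first exact: r0r.
    by rewrite /= r0t; case: (y) yO.
  by move=> z z' zO zO' _ _; apply: fy.
have [/(full_connected SA erefl) //|AB] := full_or SA SB erefl erefl.
have [/(full_connected SA erefl) //|AC] := full_or SA SC erefl erefl.
apply: (@connected_cons _ (rcons r0 SA)) => //; last 1 first.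
- have toA z : ~~ star z -> reach (z :: rcons r0 SA) (SA :: rcons r0 SA).
    by case: z => // _; [exact: reach_refl|exact: reach_sym|exact: reach_sym].
  by move=> z z' zO zO' _ _; apply: (reach_trans (toA _ zO)); apply/reach_sym/toA.
- have := r0r SB erefl; rewrite r0E /reduced /= => r0s.
  rewrite rcons_path r0s /=.
  have : star (last SO m0) by rewrite -last_map; move: lt; rewrite -r0t r0E.
  by case: last.
- by rewrite map_rcons r0t.
Qed.

Lemma sparse_rcons t b : sparse (rcons t b) -> sparse t.
Proof. by rewrite /sparse -cats1 => /cat_sorted2[]. Qed.

Lemma sparse_cons b t : sparse (b :: t) -> sparse t.
Proof. exact: path_sorted. Qed.

(** Induction on the length. A star at either end is stripped off; two non-stars at one end are
    handled by [connected_cons2], after reversal for the right end; in the remaining long case both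
    ends are a non-star next to a star, as in [connected_cons_rcons]. *)
Lemma connected_sparse t : sparse t -> connected t.
Proof.
have [n] := ubnP (size t); elim: n t => // n IH [_ _|[] t /= /ltnSE tn st].
- exact: connected_nil.
- by apply: connected_consO; apply: IH => //; exact: (sparse_cons (b := true) st).
case: t tn st => [_ _|[] t tn st]; first exact: connected1; last first.
  have := sparse_cons (b := false) st => st'.
  by apply: connected_cons2 => //; apply: IH.
case/lastP: t => [|t b] in tn st *.
  by rewrite -[[:: _; _]]/(rcons [:: false] true); exact/connected_rconsO/connected1.
have sts : sparse [:: false, true & t] by apply: (@sparse_rcons _ b).
rewrite -!rcons_cons; have cts : connected [:: false, true & t].
  by apply: IH => //; rewrite /= -(size_rcons t b).
case: b => [|] in tn st *; first exact/connected_rconsO.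
case/lastP: t => [|t []] in tn st sts cts *.
- rewrite rcons_cons; apply: connected_cons_rcons => //=.
  by apply: IH => //; exact: (sparse_cons (b := false) st).
- rewrite rcons_cons; apply: connected_cons_rcons; rewrite /= ?last_rcons //.
  by apply: IH => //; exact: (sparse_cons (b := false) st).
pose u := [:: false, true & t].
have uE : false :: rev u = rev [:: false, true & rcons t false].
  by rewrite -rev_rcons.
have -> : rcons [:: false, true & rcons t false] false = rev [:: false, false & rev u].
  by rewrite uE rev_cons revK.
apply/connected_rev/connected_cons2; rewrite uE; last exact: connected_rev.
by rewrite sparse_rev.
Qed.

Lemma reach_reduced r r' : reduced r -> reduced r' -> map star r = map star r' ->
  reach r r'.
Proof.
by move=> rr rr' e; apply: (connected_sparse (sparse_stars rr)).
Qed.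

(** A symbol that toggles the phase is not changed by flipping, and one that does not toggle leaves
    both copies in the same phase. *)
Lemma act_double g r s : act g (rcons (rcons r s) s) =
  rcons (act g (rcons r s)) (last SO (act g (rcons r s))).
Proof.
case: g; rewrite /= ?map_rcons ?last_rcons // !run_rcons last_rcons parity_rcons.
by congr rcons; case: parity s => -[].
Qed.

Lemma acts_double gs r s : acts gs (rcons (rcons r s) s) =
  rcons (acts gs (rcons r s)) (last SO (acts gs (rcons r s))).
Proof.
elim: gs r s => [|g gs IH] r s /=; first by rewrite last_rcons.
rewrite act_double; case/lastP E: (act g (rcons r s)) => [|r' s'].
  by have := stars_act g (rcons r s); rewrite E; case: (r).
by rewrite last_rcons IH.
Qed.

(** Supplies, for every sparse pattern of stars, a reduced word without [SA]; the letters [b_n] and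
    [c_n] are fixed by [lrho]. *)
Fixpoint bc_word (x : bool) (t : seq bool) : seq sym :=
  match t with
  | [::] => [::]
  | true :: t' => SO :: bc_word x t'
  | false :: t' => (if x then SB else SC) :: bc_word (~~ x) t'
  end.

Lemma stars_bc_word x t : map star (bc_word x t) = t.
Proof. by elim: t x => [|[] t IH] [] //=; rewrite IH. Qed.

Lemma all_bc_word x t : all (fun s => s != SA) (bc_word x t).
Proof. by elim: t x => [|[] t IH] [] //=; rewrite IH. Qed.

Lemma path_bc_word x t s : s != (if x then SB else SC) ->
  path (fun x y => ~~ (x && y)) (star s) t ->
  path (fun x y => x != y) s (bc_word x t).
Proof.
elim: t x s => [|[] t IH] x s //= sx /andP[st pt].
  by rewrite IH //; [case: (s) st|case: (x)].
by rewrite sx IH //; case: (x).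
Qed.

Lemma reduced_bc_word x t : sparse t -> reduced (bc_word x t).
Proof.
case: t => [|[] t] // st; last first.
  by apply: path_bc_word; [case: x|move: st; case: x].
by apply: path_bc_word => //; case: x.
Qed.

(** The letter of a state ends with the inversion of all bits, so it inverts the bit read exactly
    when the state itself does not. *)
Definition out_flips s := match s with SC | SO => true | _ => false end.

(** [SA] and [SC] contribute differently to the count and may both stand before [bc_word true],
    whose first non-star is [SB]; the choice between them adjusts the parity. *)
Lemma odd_out_flips t : sparse t -> t != [::] ->
  exists r, [/\ reduced r, map star r = t & odd (count out_flips r)].
Proof.
have letter t' s : s \in [:: SA; SC] -> sparse (false :: t') ->
    path (fun x y => x != y) s (bc_word true t').
  by rewrite !inE => /orP[]/eqP-> st; exact: path_bc_word.
case: t => // -[[|[] t] //|t] st _.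
- by exists [:: SO].
- have st' := sparse_cons st.
  case o: (odd (count out_flips (bc_word true t))).
    exists [:: SO, SC & bc_word true t].
    by split; [exact: letter|rewrite /= stars_bc_word|rewrite /= o].
  exists [:: SO, SA & bc_word true t].
  by split; [exact: letter|rewrite /= stars_bc_word|rewrite /= o].
case o: (odd (count out_flips (bc_word true t))).
  exists (SA :: bc_word true t).
  by split; [exact: letter|rewrite /= stars_bc_word|rewrite /= o].
exists (SC :: bc_word true t).
by split; [exact: letter|rewrite /= stars_bc_word|rewrite /= o].
Qed.

(** * Words of letters and the dual automaton *)

Section AleshinState.
Variable n : nat.

Definition state_code (q : aleshin_state n) : option (option (option 'I_(2 * n - 2))) :=
  match q with
  | AlA => None
  | AlB => Some None
  | AlC => Some (Some None)
  | AlQ i => Some (Some (Some i))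
  end.

Definition state_decode (c : option (option (option 'I_(2 * n - 2)))) : aleshin_state n :=
  match c with
  | None => AlA
  | Some None => AlB
  | Some (Some None) => AlC
  | Some (Some (Some i)) => AlQ i
  end.

Lemma state_codeK : cancel state_code state_decode. Proof. by case. Qed.
Lemma state_decodeK : cancel state_decode state_code. Proof. by do 3![case=> //]. Qed.

HB.instance Definition _ := Finite.copy (aleshin_state n) (can_type state_codeK).

Lemma card_aleshin_state : 0 < n -> #|{: aleshin_state n}| = 2 * n + 1.
Proof.
move=> n_gt0; have /bij_eq_card-> : bijective state_code.
  by exists state_decode; [exact: state_codeK|exact: state_decodeK].
by rewrite !card_option card_ord; case: n n_gt0 => // m _; rewrite mulnS addKn addn1.
Qed.

End AleshinState.

Section Letters.
Variable N : {fset nat}.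
Hypothesis N_gt0 : forall n : nat, n \in N -> 0 < n.

Let state := {n : N & aleshin_state (val n)}.
(* [None] is the transformation inverting every bit, and [Some q] is the
   transformation of the state [q] followed by this inversion. *)
Definition letter := option state.

Definition mkl (n : N) (q : aleshin_state (val n)) : letter :=
  Some (Tagged (fun n : N => aleshin_state (val n)) q).

Definition sym_of (x : letter) : sym :=
  if x is Some u then
    match tagged u with AlA => SA | AlB => SB | AlC => SC | AlQ _ => SO end
  else SO.

Definition relabel (x : letter) (s : sym) : letter :=
  if star (sym_of x) then x else
  if x is Some u then
    match s with
    | SA => mkl (n := tag u) AlA
    | SB => mkl (n := tag u) AlB
    | SC => mkl (n := tag u) AlC
    | SO => x
    end
  else x.

Definition lnext (x : letter) (b : bool) : letter :=
  if x is Some u then mkl (aleshin_next (tagged u) b) else None.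

Definition lout (x : letter) (b : bool) : bool :=
  if x is Some u then ~~ aleshin_output (tagged u) b else ~~ b.

Fixpoint lact1 (x : letter) (s : seq bool) : seq bool :=
  if s is b :: s' then lout x b :: lact1 (lnext x b) s' else [::].

Definition lact (t : seq letter) (s : seq bool) := foldl (fun s x => lact1 x s) s t.

Fixpoint dual (b : bool) (t : seq letter) : seq letter :=
  if t is x :: t' then lnext x b :: dual (lout x b) t' else [::].

Definition dual_out (b : bool) (t : seq letter) := foldl (fun b x => lout x b) b t.

Definition acts_trivially (t : seq letter) := lact t =1 id.

Lemma lact_cons t b s : lact t (b :: s) = dual_out b t :: lact (dual b t) s.
Proof. by rewrite /lact /dual_out; elim: t b s => //= x t IH b s; rewrite IH. Qed.

Lemma trivial_dual b t : acts_trivially t -> acts_trivially (dual b t).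
Proof. by move=> tt s; have := tt (b :: s); rewrite lact_cons => -[]. Qed.

Lemma trivial_out b t : acts_trivially t -> dual_out b t = b.
Proof. by move=> tt; have := tt [:: b]; rewrite lact_cons => -[]. Qed.

Definition lswap (f : sym -> sym) (x : letter) := relabel x (f (sym_of x)).

(** Past the last index [aleshin_q] returns [AlA], which closes the cycle; for n = 1 this is the
    identity. *)
Definition lrho (x : letter) : letter :=
  if x is Some u then
    mkl (match tagged u with
         | AlA => aleshin_q (val (tag u)) 1
         | AlQ i => aleshin_q (val (tag u)) i.+2
         | q => q end)
  else None.

Fixpoint lrun (p : bool) (t : seq letter) : seq letter :=
  if t is x :: t' then lswap (flip p) x :: lrun (p (+) toggles (sym_of x)) t'
  else [::].

Definition relabels (t : seq letter) (r : seq sym) :=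
  [seq relabel x.1 x.2 | x <- zip t r].

Inductive move := MSym of gen | MRho.

Definition mact m t :=
  match m with
  | MSym g => relabels t (act g (map sym_of t))
  | MRho => map lrho t
  end.
Definition macts ms t := foldl (fun t m => mact m t) t ms.

Variant letter_spec : letter -> Type :=
  | LetterE : letter_spec None
  | LetterA n : letter_spec (@mkl n AlA)
  | LetterB n : letter_spec (@mkl n AlB)
  | LetterC n : letter_spec (@mkl n AlC)
  | LetterQ n i : letter_spec (@mkl n (AlQ i)).

Lemma letterP x : letter_spec x.
Proof. by case: x => [[n [|||i]]|]; constructor. Qed.

Lemma lswapBC_q n k : lswap swapBC (@mkl n (aleshin_q (val n) k.+1)) = mkl (aleshin_q (val n) k.+1).
Proof. by rewrite /aleshin_q; case: insub. Qed.

Lemma lswapBCK : involutive (lswap swapBC). Proof. by move=> x; case: (letterP x). Qed.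
Lemma lswapABK : involutive (lswap swapAB). Proof. by move=> x; case: (letterP x). Qed.

Definition swapAC s := swapAB (swapBC (swapAB s)).

Lemma lswapACE x : lswap swapAC x = lswap swapAB (lswap swapBC (lswap swapAB x)).
Proof. by case: (letterP x). Qed.

(** With [D_b] for [dual b], this and the next two lemmas express the moves by the dual automaton:
    [swapBC] is [D_1 D_0^-1], [swapAB] is [D_0^-1 D_1], and [lrho] after [lrun false] is [D_0] after
    [swapAC]. *)
Lemma dualN b t : dual (~~ b) t = map (lswap swapBC) (dual b t).
Proof.
elim: t b => //= x t IH b.
have -> : lout x (~~ b) = ~~ lout x b by case: (letterP x).
rewrite IH; congr (_ :: _); case: (letterP x) b => [|n|n|n|n i] [] //=.
all: by rewrite lswapBC_q.
Qed.

Lemma dualN_swapAB b t : dual (~~ b) t = dual b (map (lswap swapAB) t).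
Proof.
elim: t b => //= x t IH b.
have -> : lout x (~~ b) = ~~ lout (lswap swapAB x) b by case: (letterP x).
by rewrite IH; congr (_ :: _); case: (letterP x) b => [|n|n|n|n i] [].
Qed.

Lemma dual_swapAC b t : dual b (map (lswap swapAC) t) = map lrho (lrun b t).
Proof.
elim: t b => //= x t IH b.
have -> : lout (lswap swapAC x) b = b (+) toggles (sym_of x).
  by case: (letterP x) b => [|n|n|n|n i] [].
by rewrite IH; congr (_ :: _); case: (letterP x) b => [|n|n|n|n i] [].
Qed.

Lemma lrunK p : involutive (lrun p).
Proof.
move=> t; elim: t p => //= x t IH p.
have -> : toggles (sym_of (lswap (flip p) x)) = toggles (sym_of x).
  by case: (letterP x) p => [|n|n|n|n i] [].
by rewrite IH; congr (_ :: _); case: (letterP x) p => [|n|n|n|n i] [].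
Qed.

Lemma lrun_lrho p t : lrun p (map lrho t) = map lrho (lrun p t).
Proof.
elim: t p => //= x t IH p.
have -> : toggles (sym_of (lrho x)) = toggles (sym_of x).
  by case: (letterP x) => //= *; rewrite /aleshin_q /=; case: insub.
rewrite IH; congr (_ :: _).
by case: (letterP x) p => [|n|n|n|n i] [] //=; rewrite /aleshin_q /=; case: insub.
Qed.

(** * The order of the cycle [lrho] *)

Lemma iter_lrho_A n k : 0 < k <= (2 * val n).-1 ->
  iter k lrho (@mkl n AlA) = mkl (aleshin_q (val n) k).
Proof.
case: k => // k /=; elim: k => //= k IH lek.
rewrite IH; last by rewrite (leq_trans _ lek).
have lt : k < 2 * val n - 2 by rewrite subn2 ltn_predRL.
by rewrite /lrho /= (insubT (fun i => i < 2 * val n - 2) lt).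
Qed.

Lemma mkl_Q n (i : 'I_(2 * val n - 2)) : iter i.+1 lrho (@mkl n AlA) = mkl (AlQ i).
Proof.
rewrite iter_lrho_A /=; first by rewrite /aleshin_q valK.
have : i < (2 * val n).-2 by rewrite -subn2; exact: ltn_ord.
by rewrite ltn_predRL => /ltnW.
Qed.

Lemma iter_lrho_order n (q : aleshin_state (val n)) : iter (2 * val n).-1 lrho (mkl q) = mkl q.
Proof.
have n0 : 0 < val n by apply: N_gt0; exact: valP.
have lt0 : 0 < (2 * val n).-1 by case: (val n) n0 => // m _; rewrite mulnS.
have A : iter (2 * val n).-1 lrho (@mkl n AlA) = @mkl n AlA.
  rewrite iter_lrho_A ?lt0 ?leqnn // /aleshin_q.
  by rewrite -(prednK lt0) insubF // subn2 ltnn.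
case: q => [|||i] //; last by rewrite -(mkl_Q i) -iterD addnC iterD A.
all: by elim: (_.-1) => //= k ->.
Qed.

Definition period := \prod_(n : N) (2 * val n).-1.

Lemma odd_period : odd period.
Proof.
rewrite /period; elim/big_ind: _ => // [x y|n _]; first by rewrite oddM => -> ->.
have n0 : 0 < val n by apply: N_gt0; exact: valP.
by case: (val n) n0 => // m _; rewrite mulnS /= oddM.
Qed.

Lemma iter_lrho_period x : iter period lrho x = x.
Proof.
case: x => [[n q]|]; last by elim: period => //= k ->.
rewrite -[Some _]/(mkl q) /period (bigD1 n) //=; elim: (\prod_(i | _) _) => [|k IH].
  by rewrite muln0.
by rewrite mulnS iterD IH iter_lrho_order.
Qed.

Lemma lrho_inj : injective lrho.
Proof.
have [k pk] : exists k, period = k.+1 by case: period odd_period => // k _; exists k.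
apply: (can_inj (g := iter k lrho)) => x; rewrite -iterSr -pk; exact: iter_lrho_period.
Qed.

Lemma dual_inj b : injective (dual b).
Proof.
have dE t : dual b t = map lrho (lrun b (map (lswap swapAC) t)).
  rewrite -dual_swapAC -map_comp map_id_in // => x _ /=.
  by rewrite !lswapACE !(lswapABK, lswapBCK).
move=> t u; rewrite !dE => /(inj_map lrho_inj)/(can_inj (lrunK b)).
apply: inj_map; apply: (can_inj (g := lswap swapAC)) => x.
by rewrite !lswapACE !(lswapABK, lswapBCK).
Qed.

(** * Stability of the trivially acting words under all moves *)

Lemma size_dual b t : size (dual b t) = size t.
Proof. by elim: t b => //= x t IH b; rewrite IH. Qed.

(** [dual b] permutes the finite set of words of a given length, so its inverse there is one of its
    iterates. *)
Lemma trivial_dualK b t : acts_trivially (dual b t) -> acts_trivially t.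
Proof.
have szd (u : (size t).-tuple letter) : size (dual b u) == size t.
  by rewrite size_dual size_tuple.
pose f u := Tuple (szd u).
have fi : injective f.
  by move=> u v /(congr1 val)/dual_inj/val_inj.
move=> tt; have /(congr1 val)/= := iter_order fi (in_tuple t).
rewrite -orderSpred iterSr; set k := _.-1 => <-.
have -> : forall u, val (iter k f u) = iter k (dual b) (val u).
  by move=> u; elim: k => //= k ->.
by elim: k => //= k; exact: trivial_dual.
Qed.

Lemma trivial_swapAB t : acts_trivially t -> acts_trivially (map (lswap swapAB) t).
Proof.
by move=> /(trivial_dual true); rewrite (dualN_swapAB false) => /trivial_dualK.
Qed.

Lemma trivial_swapBC t : acts_trivially t -> acts_trivially (map (lswap swapBC) t).
Proof.
have [k pk] : exists k, period = k.+1 by case: period odd_period => // k _; exists k.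
have [u <-] : exists u, dual false u = t.
  (* A preimage read off from [dual_swapAC]; the iterate of index [period - 1] inverts [lrho]. *)
  exists (map (lswap swapAC) (lrun false (map (iter k lrho) t))).
  rewrite dual_swapAC lrunK -map_comp map_id_in // => x _ /=.
  by rewrite -iterS -pk iter_lrho_period.
by move/trivial_dualK => tu; rewrite -dualN; exact: trivial_dual.
Qed.

Lemma trivial_rho_run t : acts_trivially t -> acts_trivially (map lrho (lrun false t)).
Proof.
move=> /trivial_swapAB/trivial_swapBC/trivial_swapAB/(trivial_dual false).
rewrite -!map_comp (eq_map (g := lswap swapAC)) ?dual_swapAC // => x /=.
by rewrite lswapACE.
Qed.

(** [lrun false] is an involution commuting with [lrho]. Raising their product to the odd power
    [period] kills [lrho] and leaves [lrun false]. *)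
Lemma trivial_run t : acts_trivially t -> acts_trivially (lrun false t).
Proof.
pose E u := map lrho (lrun false u).
have run_iter k u : lrun false (map (iter k lrho) u) = map (iter k lrho) (lrun false u).
  elim: k u => [|k IH] u; first by rewrite !map_id.
  have itS v : map (iter k.+1 lrho) v = map lrho (map (iter k lrho) v).
    by rewrite -map_comp.
  by rewrite !itS lrun_lrho IH.
have iterE k : iter k E t = map (iter k lrho) (iter k (lrun false) t).
  elim: k => [|k IH]; first by rewrite map_id.
  by rewrite iterS IH /E run_iter -map_comp.
move=> tt; have -> : lrun false t = iter period E t.
  rewrite iterE map_id_in => [|x _]; last exact: iter_lrho_period.
  rewrite -[period]odd_double_half odd_period.
  congr lrun; elim: (_./2) => //= k IH.
  by rewrite -IH lrunK.
by elim: period => //= k; exact: trivial_rho_run.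
Qed.

Lemma trivial_rho t : acts_trivially t -> acts_trivially (map lrho t).
Proof. by move=> /trivial_run/trivial_rho_run; rewrite lrunK. Qed.

Lemma relabels_map f t : relabels t (map f (map sym_of t)) = map (lswap f) t.
Proof. by rewrite /relabels; elim: t => //= x t ->. Qed.

Lemma relabels_run p t : relabels t (run p (map sym_of t)) = lrun p t.
Proof. by rewrite /relabels; elim: t p => //= x t IH p; rewrite IH. Qed.

Lemma trivial_mact m t : acts_trivially t -> acts_trivially (mact m t).
Proof.
case: m => [[]|] /=; rewrite ?relabels_map ?relabels_run.
- exact: trivial_swapAB.
- exact: trivial_swapBC.
- exact: trivial_run.
- exact: trivial_rho.
Qed.

Lemma trivial_macts ms t : acts_trivially t -> acts_trivially (macts ms t).
Proof. by elim: ms t => //= m ms IH t /(trivial_mact m); exact: IH. Qed.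

Lemma sym_relabel x s : star (sym_of x) = star s -> sym_of (relabel x s) = s.
Proof. by case: (letterP x) => [|n|n|n|n i]; case: s. Qed.

Lemma syms_relabels t r : map star (map sym_of t) = map star r ->
  map sym_of (relabels t r) = r.
Proof.
rewrite /relabels; elim: t r => [|x t IH] [|s r] //= [xs tr].
by rewrite sym_relabel // IH.
Qed.

Lemma relabels_relabels t r r' : map star (map sym_of t) = map star r ->
  map star r = map star r' -> relabels (relabels t r) r' = relabels t r'.
Proof.
rewrite /relabels; elim: t r r' => [|x t IH] [|s r] [|s' r'] //= [xs tr] [ss' rr'].
rewrite IH //; congr (_ :: _).
by case: (letterP x) xs ss' => [|n|n|n|n i]; case: s => //; case: s'.
Qed.

Lemma relabels_id t : relabels t (map sym_of t) = t.
Proof.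
rewrite /relabels; elim: t => //= x t ->; congr (_ :: _).
by case: (letterP x).
Qed.

Lemma macts_acts gs t : macts (map MSym gs) t = relabels t (acts gs (map sym_of t)).
Proof.
elim: gs t => [|g gs IH] t /=; first by rewrite relabels_id.
have E : map star (map sym_of t) = map star (act g (map sym_of t)) by rewrite stars_act.
by rewrite -/(macts _ _) IH syms_relabels // relabels_relabels // stars_acts.
Qed.

Lemma macts_cat ms ms' t : macts (ms ++ ms') t = macts ms' (macts ms t).
Proof. exact: foldl_cat. Qed.

Lemma reach_relabels t r : reduced (map sym_of t) -> reduced r ->
  map star (map sym_of t) = map star r -> exists gs,
  acts gs (map sym_of t) = r /\ macts (map MSym gs) t = relabels t r.
Proof.
by move=> tr rr e; have [gs gsr] := reach_reduced tr rr e; exists gs; rewrite macts_acts gsr.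
Qed.

Lemma relabels_rcons t x r s : size t = size r ->
  relabels (rcons t x) (rcons r s) = rcons (relabels t r) (relabel x s).
Proof. by move=> e; rewrite /relabels zip_rcons // map_rcons. Qed.

Lemma size_mact m t : size (mact m t) = size t.
Proof.
case: m => [g|]; rewrite ?size_map // size_zip.
have := stars_act g (map sym_of t) => /(congr1 size).
by rewrite !size_map => ->; rewrite minnn.
Qed.

Lemma macts_rcons ms u : exists f : letter -> letter,
  forall z, macts ms (rcons u z) = rcons (macts ms u) (f z).
Proof.
elim: ms u => [|m ms IH] u; first by exists id.
have [f fE] := IH (mact m u).
case: m => [g|] in f fE *; last by exists (f \o lrho) => z; rewrite /= map_rcons; exact: fE.
have [h _ hE] := acts_rcons [:: g] (map sym_of u).
exists (f \o fun z => relabel z (h (sym_of z))) => z.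
rewrite [LHS]/= map_rcons [act _ _]hE relabels_rcons; first exact: fE.
by have /(congr1 size) := stars_act g (map sym_of u); rewrite !size_map.
Qed.

(** * Nontriviality of reduced words *)

Lemma lswap_flip_inj p : injective (lswap (flip p)).
Proof. by apply: inv_inj => x; case: (letterP x) p => [|n|n|n|n i] []. Qed.

Lemma reduced_lrun p t : reduced (lrun p t) = reduced t.
Proof.
elim: t p => [|x [|y t] IH] p //.
have := IH (p (+) toggles (sym_of x)); rewrite /reduced /= => ->; congr (_ && _).
(* A toggling letter is not changed by flipping, so it may be taken in the phase of its right
   neighbour; both are then moved by one injection. *)
have -> : lswap (flip p) x = lswap (flip (p (+) toggles (sym_of x))) x.
  by case: (letterP x) p => [|n|n|n|n i] [].
by rewrite (inj_eq (@lswap_flip_inj _)).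
Qed.

Lemma reduced_mact m t : reduced (mact m t) = reduced t.
Proof.
case: m => [[]|] /=; rewrite ?relabels_map ?relabels_run.
- exact: (reduced_map _ (inv_inj lswapABK)).
- exact: (reduced_map _ (inv_inj lswapBCK)).
- exact: reduced_lrun.
- exact: (reduced_map _ lrho_inj).
Qed.

Lemma reduced_macts ms t : reduced (macts ms t) = reduced t.
Proof. by elim: ms t => //= m ms IH t; rewrite IH reduced_mact. Qed.

Lemma macts_rho j t : macts (nseq j MRho) t = map (iter j lrho) t.
Proof.
elim: j t => [|j IH] t /=; first by rewrite map_id.
by rewrite -/(macts _ _) IH -map_comp; apply: eq_map => x /=; rewrite -iterSr.
Qed.

(** * Moving a reduced word to one with reduced symbols *)

Definition plain (x : letter) := (x == None) || ~~ star (sym_of x).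
(** The letters [e], [b_n], [c_n]: since [lrho] fixes them, it can alter the end of a word without
    disturbing a low prefix. *)
Definition low (x : letter) := plain x && (sym_of x != SA).
Definition good (t : seq letter) := all low t && reduced (map sym_of t).

Lemma low_plain x : low x -> plain x. Proof. by case/andP. Qed.

Lemma low_iter j x : low x -> iter j lrho x = x.
Proof. by move=> lx; elim: j => //= j ->; case: (letterP x) lx. Qed.

Lemma low_rho j t : all low t -> map (iter j lrho) t = t.
Proof. by move=> lt; rewrite map_id_in // => x /(allP lt); exact: low_iter. Qed.

(** The stars of a plain word are all [e], so relabelling by a [bc_word] leaves only low letters. *)
Lemma good_reach t : all plain t -> reduced (map sym_of t) ->
  exists ms, good (macts ms t).
Proof.
move=> pt rt; pose r := bc_word true (map star (map sym_of t)).
have rs : map star r = map star (map sym_of t) by exact: stars_bc_word.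
have rr : reduced r by apply/reduced_bc_word/sparse_stars.
have [gs [_ gsE]] := reach_relabels rt rr (esym rs).
exists (map MSym gs); rewrite gsE /good syms_relabels // rr andbT.
have : all (fun s => s != SA) r by exact: all_bc_word.
elim: t r pt rs {rt rr gsE} => [|x t IH] [|s r] //= /andP[px pt] [xs tr] /andP[sA rA].
rewrite IH // andbT.
by case: (letterP x) px xs sA => [|n|n|n|n i]; case: s.
Qed.

Lemma rho_to_A n (i : 'I_(2 * val n - 2)) : exists j, iter j lrho (mkl (AlQ i)) = @mkl n AlA.
Proof.
exists ((2 * val n).-1 - i.+1); rewrite -(mkl_Q i) -iterD subnK ?iter_lrho_order //.
have : i < (2 * val n).-2 by rewrite -subn2; exact: ltn_ord.
by rewrite ltn_predRL => /ltnW.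
Qed.

Lemma good_reach_trans ms t : (exists ms', good (macts ms' (macts ms t))) ->
  exists ms', good (macts ms' t).
Proof. by case=> ms' g; exists (ms ++ ms'); rewrite macts_cat. Qed.

Lemma reduced_rcons (T : eqType) (w : seq T) x y :
  reduced (rcons (rcons w x) y) = reduced (rcons w x) && (x != y).
Proof.
by case: w => [|z w]; rewrite /reduced /= ?andbT // !rcons_path last_rcons.
Qed.

(** Iterating [lrho] fixes [u] and turns the last letter into an [a], whose symbol differs from that
    of any low letter before it. *)
Lemma good_rcons_Q u n (i : 'I_(2 * val n - 2)) : good u ->
  exists ms, good (macts ms (rcons u (mkl (AlQ i)))).
Proof.
move=> /andP[lu ru]; have [j jE] := rho_to_A i.
apply: (@good_reach_trans (nseq j MRho)).
rewrite macts_rho map_rcons low_rho // jE; apply: good_reach.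
  by rewrite all_rcons /= (sub_all low_plain).
case/lastP: u lu ru => // u x; rewrite all_rcons !map_rcons => /andP[/andP[_ xA] _] ru.
by rewrite reduced_rcons ru.
Qed.

(* [x] and [y] have different types, so the periods of their images under
   [lrho] differ: after moving both to [a]'s, an iterate of [lrho] brings back
   the one of smaller period only and so makes their symbols different. *)
Lemma good_rcons_double v x y : good (rcons v x) -> reduced (rcons (rcons v x) y) ->
  ~~ star (sym_of x) -> sym_of y = sym_of x ->
  exists ms, good (macts ms (rcons (rcons v x) y)).
Proof.
move=> gvx rvxy xO yx; have /andP[] := gvx.
rewrite all_rcons map_rcons => /andP[lx lv] rvx.
have [m [n [xm yn mn]]] : exists m n, [/\ relabel x SA = @mkl m AlA,
    relabel y SA = @mkl n AlA & val m != val n].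
  have : x != y by move: rvxy; rewrite reduced_rcons => /andP[].
  case: (letterP x) yx xO => [//|m|m|m|//]; case: (letterP y) => // n _ _ xy;
    exists m, n; split=> //; apply: contra xy => /eqP/val_inj-> //.
have rvA : reduced (rcons (map sym_of v) SA).
  case/lastP: v lv {gvx rvxy} rvx => // v z; rewrite all_rcons !map_rcons !reduced_rcons.
  by move=> /andP[/andP[_ ->] _] /andP[-> _].
(* The symbols of [x] and [y] agree, so by [acts_double] the moves making the first an [a] do the
   same to the second. *)
have [|||gs [gsE _]] := @reach_relabels (rcons v x) (rcons (map sym_of v) SA);
  rewrite ?map_rcons //.
  by congr rcons; case: (sym_of x) xO.
apply: (@good_reach_trans (map MSym gs)).
have -> : macts (map MSym gs) (rcons (rcons v x) y) = rcons (rcons v (@mkl m AlA)) (@mkl n AlA).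
  rewrite macts_acts !map_rcons yx acts_double -map_rcons gsE last_rcons.
  by rewrite !relabels_rcons ?size_rcons ?size_map // relabels_id xm yn.
have m0 : 0 < (2 * val m).-1.
  by have := N_gt0 (valP m); case: (val m) => // k _; rewrite mulnS.
have n0 : 0 < (2 * val n).-1.
  by have := N_gt0 (valP n); case: (val n) => // k _; rewrite mulnS.
have lrhoQ (k : N) l : 0 < l < (2 * val k).-1 ->
    exists i : 'I_(2 * val k - 2), iter l lrho (@mkl k AlA) = mkl (AlQ i).
  case: l => // l /= lk; have lt : l < 2 * val k - 2 by rewrite subn2 ltn_predRL.
  by exists (Ordinal lt); rewrite -(mkl_Q (Ordinal lt)).
have [ltmn|ltnm|/eqP] := ltngtP (val m) (val n); last by rewrite (negPf mn).
  (* The first [a] returns while the second becomes a star; undoing the symbol moves then restores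
     [rcons v x] in front of this star. *)
  apply: (@good_reach_trans (nseq (2 * val m).-1 MRho)).
  rewrite macts_rho !map_rcons low_rho // iter_lrho_order.
  have [|i ->] := lrhoQ n (2 * val m).-1.
    by rewrite m0 /= -ltnS !prednK ?muln_gt0 ?(N_gt0 (valP _)) // ltn_mul2l.
  have [|||gs' [gsE' _]] := @reach_relabels (rcons v (@mkl m AlA)) (map sym_of (rcons v x));
    rewrite ?map_rcons //.
    by congr rcons; case: (sym_of x) xO.
  apply: (@good_reach_trans (map MSym gs')).
  have -> : macts (map MSym gs') (rcons (rcons v (@mkl m AlA)) (mkl (AlQ i))) =
      rcons (rcons v x) (mkl (AlQ i)).
    have [f [_ fO] fE] := acts_rcons gs' (rcons (map sym_of v) SA).
    rewrite macts_acts !map_rcons fE fO; rewrite !map_rcons in gsE'; rewrite gsE'.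
    rewrite !relabels_rcons ?size_rcons ?size_map // relabels_id -xm.
    by congr (rcons (rcons _ _) _); case: (letterP x) xO.
  exact: good_rcons_Q.
apply: (@good_reach_trans (nseq (2 * val n).-1 MRho)).
rewrite macts_rho !map_rcons low_rho // iter_lrho_order.
have [|i ->] := lrhoQ m (2 * val n).-1.
  by rewrite n0 /= -ltnS !prednK ?muln_gt0 ?(N_gt0 (valP _)) // ltn_mul2l.
have [j jE] := rho_to_A i.
have plain_v : all plain v := sub_all low_plain lv.
(* Here the first [a] has become a star. If a star may follow [v], set the last symbol to [SB] and
   rotate the star back to an [a]. *)
have [rvO|] := boolP (reduced (rcons (map sym_of v) SO)).
  pose r := rcons (rcons (map sym_of v) SO) SB.
  have [|||gs' [_ gsE']] := @reach_relabels (rcons (rcons v (mkl (AlQ i))) (@mkl n AlA)) r.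
  - by rewrite !map_rcons reduced_rcons rvO.
  - by rewrite reduced_rcons rvO.
  - by rewrite !map_rcons.
  apply: (@good_reach_trans (map MSym gs')).
  rewrite gsE' !relabels_rcons ?size_rcons ?size_map // relabels_id.
  apply: (@good_reach_trans (nseq j MRho)).
  rewrite macts_rho !map_rcons low_rho // [iter j lrho (relabel (mkl (AlQ i)) _)]jE low_iter //.
  apply: good_reach; first by rewrite !all_rcons.
  by rewrite !map_rcons reduced_rcons rvA.
case/lastP: v => [//|v z] in gvx rvxy lv rvx rvA gsE plain_v *.
rewrite map_rcons reduced_rcons => rvz.
have rv_z : reduced (rcons (map sym_of v) (sym_of z)).
  by move: rvA; rewrite map_rcons reduced_rcons => /andP[].
have zE : z = None.
  move: lv rvz; rewrite all_rcons rv_z => /andP[/andP[+ _] _] /=.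
  by case: (letterP z).
rewrite zE in rv_z *.
have lv1 : all low v by move: lv; rewrite all_rcons => /andP[].
have vP s : s != SO -> s != last SO (map sym_of v) -> reduced (rcons (map sym_of v) s).
  case/lastP: (v) rv_z => // v' z'.
  by rewrite !map_rcons !reduced_rcons last_rcons => /andP[-> _] _; rewrite eq_sym.
have [s sBC sv] : exists2 s, s \in [:: SB; SC] & s != last SO (map sym_of v).
  by case: (last _ _); [exists SB|exists SC|exists SB|exists SB].
have rvs : reduced (rcons (map sym_of v) s) by apply: vP sv; case: (s) sBC.
have rvA' : reduced (rcons (map sym_of v) SA).
  apply: vP => //; case/lastP: (v) lv1 => // v' z'.
  by rewrite all_rcons map_rcons last_rcons eq_sym => /andP[/andP[]].
(* Now an [e] precedes the new star. Moves taking [SA] to [s] after the shortened [v] also do so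
   across the two stars, by [acts_rconsOO]; rotating the second star to an [a] then gives the final
   symbols [SO], [SA], [s]. *)
have [|||gs' [gsE' _]] := @reach_relabels (rcons v (@mkl n AlA)) (rcons (map sym_of v) s).
- by rewrite map_rcons.
- by [].
- by rewrite !map_rcons; congr rcons; case: (s) sBC.
have [f [_ fO] fE] := acts_rconsOO gs' (map sym_of v).
have [fE1 fE2] := fE SA.
apply: (@good_reach_trans (map MSym gs')).
rewrite macts_acts !map_rcons fE2.
move: gsE'; rewrite map_rcons fE1 => /rcons_inj[-> ->].
rewrite !relabels_rcons ?size_rcons ?size_map // relabels_id.
apply: (@good_reach_trans (nseq j MRho)).
rewrite macts_rho !map_rcons low_rho // [iter j lrho (relabel (mkl (AlQ i)) _)]jE.
rewrite (@low_iter _ (relabel _ s)) ?(@low_iter _ (relabel _ SO)) //; last by case: (s) sBC.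
apply: good_reach.
  by rewrite !all_rcons (sub_all low_plain) // andbT; case: (s) sBC.
by rewrite !map_rcons !reduced_rcons rv_z; case: (s) sBC.
Qed.

Lemma good_rcons u z : good u -> reduced (rcons u z) ->
  exists ms, good (macts ms (rcons u z)).
Proof.
move=> gu ruz; have /andP[lu ru] := gu.
have [rs|nrs] := boolP (reduced (map sym_of (rcons u z))).
  have : plain z -> exists ms, good (macts ms (rcons u z)).
    by move=> pz; apply: good_reach => //; rewrite all_rcons pz (sub_all low_plain).
  by case: (letterP z) => [|n|n|n|n i] H; first [exact: H|exact: good_rcons_Q].
case/lastP: u => [//|v x] in gu ruz lu ru nrs *.
have zx : sym_of z = sym_of x.
  by apply/eqP; move: nrs ru; rewrite !map_rcons reduced_rcons eq_sym => /nandP[/negPf->|/negPn].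
have [xO|xO] := boolP (star (sym_of x)); last exact: good_rcons_double.
have xE : x = None.
  move: lu; rewrite all_rcons => /andP[/low_plain + _]; rewrite /plain xO orbF.
  by move/eqP.
subst x; case: (letterP z) zx ruz => [|n|n|n|n i] // _; last by move=> _; exact: good_rcons_Q.
by rewrite reduced_rcons eqxx andbF.
Qed.

(** Moves act on a prefix independently of the last letter, so the prefix is made good first; the
    word stays reduced meanwhile. *)
Lemma good_exists t : reduced t -> exists ms, good (macts ms t).
Proof.
elim/last_ind: t => [|u z IH] ruz; first by exists [::].
have [|ms gms] := IH; first by move: ruz; rewrite /reduced -cats1 => /cat_sorted2[].
apply: (@good_reach_trans ms).
have [f fE] := macts_rcons ms u; rewrite fE; apply: good_rcons => //.
by rewrite -fE reduced_macts.
Qed.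

Lemma dual_outE b t : dual_out b t = b (+) odd (count out_flips (map sym_of t)).
Proof.
rewrite /dual_out; elim: t b => [|x t IH] b /=; first by rewrite addbF.
by rewrite IH oddD; case: (letterP x) b => [|n|n|n|n i] [] //=; case: odd.
Qed.

(** A nonempty word would be moved to a good one and from there to one with an odd number of
    inverting letters, which changes the first bit. *)
Lemma reduced_trivial t : reduced t -> acts_trivially t -> t = [::].
Proof.
move=> rt tt; have [ms /andP[_ rs]] := good_exists rt.
have szE : size (macts ms t) = size t.
  by elim: ms (t) {rs} => //= m ms' IH u; rewrite IH size_mact.
have /(@trivial_macts ms) tu := tt.
apply/eqP; rewrite -size_eq0 -szE size_eq0; apply/negPn/negP => t0.
have [|r [rr /esym rE ro]] := odd_out_flips (sparse_stars rs).
  by move: t0; rewrite -!size_eq0 !size_map.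
have [gs [_ gsE]] := reach_relabels rs rr rE.
have /(trivial_out false) := trivial_macts (map MSym gs) tu.
by rewrite gsE dual_outE syms_relabels // ro.
Qed.

End Letters.

(** * Free bases *)

Section FreeCriterion.
Local Open Scope group_scope.

Definition eval (B : Type) (G : groupType) (b : B -> G) (w : seq (B * bool)) : G :=
  foldr (fun x g => (if x.2 then b x.1 else (b x.1)^-1) * g) 1 w.

Definition freely_reduced (B : eqType) (w : seq (B * bool)) :=
  sorted (fun x y => (x.1 == y.1) ==> (x.2 == y.2)) w.

Definition word_inv (B : Type) (w : seq (B * bool)) := rev [seq (x.1, ~~ x.2) | x <- w].

Lemma eval_cat B (G : groupType) (b : B -> G) w w' :
  eval b (w ++ w') = eval b w * eval b w'.
Proof. by elim: w => [|x w IH] /=; rewrite ?mul1g // IH mulgA. Qed.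

Lemma eval_inv B (G : groupType) (b : B -> G) w : eval b (word_inv w) = (eval b w)^-1.
Proof.
elim: w => [|[x s] w IH] /=; first by rewrite invg1.
rewrite /word_inv /= rev_cons -cats1 eval_cat -/(word_inv w) IH /= mulg1 invgM.
by case: s => //=; rewrite invgK.
Qed.

Lemma freely_reducedPn (B : eqType) (w : seq (B * bool)) : ~~ freely_reduced w ->
  exists u x s v, w = u ++ [:: (x, s), (x, ~~ s) & v].
Proof.
elim: w => // -[x s] [//|[y s'] w] IH; rewrite /freely_reduced /= negb_and.
case/orP => [|/IH[u [z [t [v ->]]]]]; last by exists ((x, s) :: u), z, t, v.
rewrite negb_imply => /andP[/eqP-> ss'].
by exists [::], y, s, w; congr [:: _, (_, _) & _]; case: s s' ss' {IH} => -[].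
Qed.

Variables (B : eqType) (G : groupType) (b : B -> G).
Hypothesis eval_surj : forall g, exists w, eval b w = g.
Hypothesis eval_free : forall w, freely_reduced w -> eval b w = 1 -> w = [::].

(** A word that is not freely reduced contains a cancelling pair, whose removal changes neither
    evaluation. *)
Lemma eval_eq1 (H : groupType) (f : B -> H) w : eval b w = 1 -> eval f w = 1.
Proof.
have [n] := ubnP (size w); elim: n w => // n IH w wn wb.
have [/eval_free->//|/freely_reducedPn[u [x [s [v wE]]]]] := boolP (freely_reduced w).
have cancel_xs (K : groupType) (h : B -> K) : eval h w = eval h (u ++ v).
  rewrite wE !eval_cat /=.
  by case: s {wE}; rewrite /= ?mulKg ?mulVKg.
rewrite cancel_xs; apply: IH; last by rewrite -cancel_xs.
by move: wn; rewrite wE !size_cat /= !addnS ltnS => /ltnW.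
Qed.

Lemma eval_eq (H : groupType) (f : B -> H) w w' : eval b w = eval b w' -> eval f w = eval f w'.
Proof.
move=> e; apply/eqP; rewrite -divg_eq1 -eval_inv -eval_cat.
by apply/eqP/eval_eq1; rewrite eval_cat eval_inv e mulgV.
Qed.

Lemma free_basis_of_reduced : free_basis b.
Proof.
move=> H f; pose phi g := eval f (sval (cid (eval_surj g))).
have phiE w : phi (eval b w) = eval f w.
  by rewrite /phi; case: cid => w' /= /eval_eq.
have phiM : {morph phi : x y / x * y}.
  move=> x y; have [u <-] := eval_surj x; have [v <-] := eval_surj y.
  by rewrite -eval_cat !phiE eval_cat.
pose phi_mul := isMultiplicative.Build G H phi phiM.
pose phi' : {multiplicative G -> H} := HB.pack phi phi_mul.
exists phi' => [i|psi psib g].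
  have := phiE [:: (i, true)]; by rewrite /= !mulg1.
have psi1 : psi 1 = 1.
  by apply: (mulgI (psi 1)); rewrite -gmulfM !mulg1.
have psiV x : psi x^-1 = (psi x)^-1.
  by apply: (mulgI (psi x)); rewrite -gmulfM !mulgV.
have [w <-] := eval_surj g; rewrite -[RHS]/(phi _) phiE.
elim: w => [|[x s] w IH] //=.
by rewrite gmulfM IH; case: s; rewrite ?psiV psib.
Qed.

End FreeCriterion.

Lemma free_basis_bij (A B : Type) (G : groupType) (e : A -> B) (b : B -> G) :
  bijective e -> free_basis b -> free_basis (b \o e).
Proof.
move=> [e' eK e'K] fb H f; have [phi phib phi_uniq] := fb H (f \o e').
exists phi => [i|psi psib]; first by rewrite /= phib /= eK.
by apply: phi_uniq => i; rewrite /= -psib /= e'K.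
Qed.

(** * Freeness of the group generated by the states *)

Section Generators.
Local Open Scope group_scope.
Variables (N : {fset nat}) (N_neq0 : N != fset0).
Hypothesis N_gt0 : forall n : nat, n \in N -> 0 < n.

Let Q := {n : N & aleshin_state (val n)}.
Let Y := aleshin_union N_neq0.
Let G := automaton_group (aleshin_union_invertible N_neq0).
Let bij_of (q : Q) : self_bij (seq bool) := mk_bij (aleshin_union_invertible N_neq0 q).

Lemma state_generated q : generated_pred
  [set bij_of q | q in [set: Q]]%classic (bij_of q).
Proof.
by rewrite /generated_pred /= in_setE => H [_ SH]; apply: SH; exists q.
Qed.

Definition state_gen (q : Q) : G := GeneratedGroup (state_generated q).

Lemma state_gen_surj g : exists w, eval state_gen w = g.
Proof.
have [w wg] : exists w, val (eval state_gen w) = val g; last by exists w; exact: val_inj.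
have := valP g; rewrite /generated_pred /= in_setE.
move=> /(_ [set x | exists w, val (eval state_gen w) = x]%classic); apply; split.
  split; first by exists [::].
  move=> _ _ [u <-] [v <-]; exists (u ++ word_inv v).
  by rewrite eval_cat eval_inv.
move=> _ [q _ <-]; exists [:: (q, true)].
by rewrite /= mulg1.
Qed.

Lemma lact1_None s : lact1 (N := N) None s = map negb s.
Proof. by elim: s => //= b s ->. Qed.

Lemma lact1_Some (q : Q) s : lact1 (Some q) s = map negb (transf (Y := Y) q s).
Proof. by elim: s q => //= b s IH q; rewrite -IH. Qed.

Lemma lact1K (x : letter N) : involutive (lact1 x).
Proof.
move=> s; elim: s x => //= b s IH x.
have -> : lnext x (lout x b) = lnext x b by case: (letterP x) b => [|n|n|n|n i] [].
by rewrite IH; congr (_ :: _); case: (letterP x) b => [|n|n|n|n i] [].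
Qed.

(** Composes in the order of [eval], rightmost letter first; since letters are involutions, this
    inverts [lact t]. *)
Definition lcomp (t : seq (letter N)) (s : seq bool) := foldr (@lact1 N) s t.

Lemma lact_lcomp t s : lact t (lcomp t s) = s.
Proof. by elim: t => //= x t IH; rewrite /lact /= lact1K; exact: IH. Qed.

Definition cons_None (t : seq (letter N)) : seq (letter N) :=
  if t is None :: t' then t' else None :: t.

(** Writes [A_q] as [e B_q] and its inverse as [B_q e]; [cons_None] cancels two adjacent [e]. *)
Fixpoint letters_of (w : seq (Q * bool)) : seq (letter N) :=
  match w with
  | [::] => [::]
  | (q, true) :: w' => None :: Some q :: letters_of w'
  | (q, false) :: w' => Some q :: cons_None (letters_of w')
  end.

Lemma lcomp_cons_None t s : lcomp (cons_None t) s = lact1 (N := N) None (lcomp t s).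
Proof. by case: t => [|[q|] t] //=; rewrite lact1K. Qed.

Lemma lcomp_letters_of w s : lcomp (letters_of w) s = val (eval state_gen w) s.
Proof.
elim: w => //= -[q [|]] w IH /=.
  rewrite IH lact1_None lact1_Some -map_comp map_id_in // => x _ /=; exact: negbK.
rewrite -/(lcomp _ _) lcomp_cons_None IH.
set s' := (X in lact1 None X); apply: (can_inj (@bij_funK _ (bij_of q))).
rewrite -[RHS]/(bij_of q (bij_inv_fun (bij_of q) s')) bij_inv_funK.
rewrite -[LHS]/(transf (Y := Y) q _).
rewrite -[transf _ _](mapK negbK) -lact1_Some lact1K lact1_None.
exact: (mapK negbK).
Qed.

(** Two state letters become adjacent only between opposite exponents, where free reducedness makes
    the states different. *)
Lemma reduced_letters_of w : freely_reduced w -> reduced (letters_of w).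
Proof.
elim: w => // -[q s] [_ _|[q' s'] w IH rw]; first by case: s.
have {IH} := IH (path_sorted rw); move: rw => /= /andP[qq' _].
case: s s' qq' => -[] //=; rewrite /reduced /= ?implybF ?andbT.
  by move=> qq' ->; rewrite andbT.
by move=> qq' ->; rewrite andbT.
Qed.

Lemma state_gen_free w : freely_reduced w -> eval state_gen w = 1 -> w = [::].
Proof.
move=> rw w1; have compK s : lcomp (letters_of w) s = s.
  by rewrite lcomp_letters_of w1.
have lw : letters_of w = [::].
  apply: (reduced_trivial N_gt0); first exact: reduced_letters_of.
  by move=> s; rewrite -[s in LHS]compK lact_lcomp.
by case: w lw {rw w1 compK} => // -[q []].
Qed.

Lemma free_basis_state_gen : free_basis state_gen.
Proof. exact: free_basis_of_reduced state_gen_surj state_gen_free. Qed.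

Lemma card_states : #|{: Q}| = (\sum_(n <- N) (2 * n + 1))%N.
Proof.
rewrite card_tagged sumnE big_map big_enum big_seq_fsetE.
by apply: eq_bigr => n _; rewrite card_aleshin_state // N_gt0 // (valP n).
Qed.

End Generators.

Theorem theorem1p3 (N : {fset nat}) (N_neq0 : N != fset0)
    (N_gt0 : forall n : nat, n \in N -> 0 < n) :
  free_of_rank (automaton_group (aleshin_union_invertible N_neq0))
    (\sum_(n <- N) (2 * n + 1)).
Proof.
rewrite -(card_states N_gt0); exists (state_gen N_neq0 \o enum_val).
apply: free_basis_bij (free_basis_state_gen N_neq0 N_gt0).
exact: enum_val_bij.
Qed.
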